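(* Let $X$ be a topological space, $(Y,\langle\cdot,\cdot\rangle)$ a real Hilbert space with induced norm $\|\cdot\|$, $T\subseteq Y$ a convex set dense in $Y$, and $I:X\to\mathbf{R}$, $\varphi:X\to Y$ two functions such that, for each $y\in T$, the function $x\mapsto I(x)+\langle\varphi(x),y\rangle$ is lower semicontinuous and inf-compact on $X$. Moreover, assume that there exists a point $x_0\in X$, with $\varphi(x_0)\neq 0$, such that (a) $x_0$ is a global minimum of both functions $I$ and $x\mapsto\|\varphi(x)\|$; (b) $\inf_{x\in X}\langle\varphi(x),\varphi(x_0)\rangle<\|\varphi(x_0)\|^2$. Then, for each convex set $S\subseteq T$ dense in $Y$, there exists $y^*\in S$ such that the function $x\mapsto I(x)+\langle\varphi(x),y^*\rangle$ has at least two global minima in $X$.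
   Context: A function $g:X\to\mathbf{R}$ on a topological space $X$ is said to be inf-compact if, for each $r\in\mathbf{R}$, the set $g^{-1}(]-\infty,r])$ is compact. ''Global minimum'' means a global minimum point, so ''at least two global minima'' means at least two distinct points of $X$ at which the function attains its infimum over $X$. *)

(* Defs.v *)
From HB Require Import structures.
From mathcomp Require Import all_boot all_order all_algebra.
From mathcomp Require Import all_classical all_reals all_analysis.

Set Implicit Arguments.
Unset Strict Implicit.
Unset Printing Implicit Defensive.

Import Order.TTheory GRing.Theory Num.Theory.
Import numFieldNormedType.Exports.

Local Open Scope classical_set_scope.
Local Open Scope ring_scope.

(* A real Hilbert space is a complete normed space [Y] whose norm is induced by
   the inner product [dot] (a symmetric, positive definite bilinear form). *)
Definition norm_induced_by (R : realType) (Y : normedModType R)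
    (dot : {dot Y for (@idfun R)}) : Prop :=
  forall y : Y, `|y| = Num.sqrt (dot y y).

(* Compactness of a subset is the open-cover notion; no separation axiom. *)
Definition inf_compact (R : realType) (X : topologicalType) (g : X -> R) : Prop :=
  forall r : R, compact (g @^-1` `]-oo, r]).

Definition global_min (R : realType) (X : Type) (g : X -> R) (x : X) : Prop :=
  forall z : X, g x <= g z.

(* Main.v *)
(* Suppose that for every y in S the function I + <phi, y> has a single global
   minimum. Let C be the intersection of S with a ball of radius rho. An affine
   minimax equality holds on C: on a compact convex hull of finitely many points
   y_i of C, the function y |-> min_x (I x + <phi x, y>) is maximal at some ym,
   and uniqueness of the minimizer xm at ym forces I xm + <phi xm, y_i> to be at
   most that maximum for all i; compactness of the sublevel sets then passes from
   finite subsets to C. By density of S, the inf-sup is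
   inf_x (I x + rho |phi x|) = I x0 + rho |phi x0|, whereas (b) makes the sup-inf
   strictly smaller once rho is large: a contradiction. *)

Require Import Defs.
From HB Require Import structures.
From mathcomp Require Import all_boot all_order all_algebra.
From mathcomp Require Import all_classical all_reals all_analysis.
From mathcomp Require Import ring lra.

Set Implicit Arguments.
Unset Strict Implicit.
Unset Printing Implicit Defensive.

Import Order.TTheory GRing.Theory Num.Theory.
Import numFieldNormedType.Exports.

Local Open Scope classical_set_scope.
Local Open Scope ring_scope.

(** * Compactness and attained minima *)

(** The traces of the [F i] on [K] generate a proper filter, and a cluster point of it in [K] lies
    in each closed [F i]. *)
Lemma compact_finite_intersection (X : topologicalType) (J : choiceType)
    (K : set X) (D : set J) (F : J -> set X) :
  compact K -> (forall i, D i -> closed (F i)) ->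
  (forall s : seq J, (forall i, i \in s -> D i) ->
     exists2 x, K x & forall i, i \in s -> F i x) ->
  exists2 x, K x & forall i, D i -> F i x.
Proof.
move=> cK clF finF.
have [[i0 Di0]|D0] := pselect (exists i, D i); last first.
  have [//|x Kx _] := finF [::].
  by exists x => // i Di; case: D0; exists i.
have finI_KF : finI D (fun i => K `&` F i).
  move=> s sD; have [i /sD|x Kx Fx] := finF (finmap.enum_fset s).
    by rewrite inE.
  by exists x => i /= si; split=> //; exact: Fx.
have [|x [Kx clx]] := cK _ (finI_filter finI_KF).
  exists (K `&` F i0); last exact: subIsetl.
  exact: (finI_from1 (fun i => K `&` F i)).
exists x => // i Di; apply: (clF i Di) => B xB.
have [|z [[_ Fz] Bz]] := clx (K `&` F i) B _ xB; last by exists z.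
by exists (K `&` F i) => //; exact: (finI_from1 (fun i => K `&` F i)).
Qed.

(** Sublevel sets are taken at the values of [h] on [K]: among finitely many values, a point
    attaining the least lies in all the sublevel sets, so by compactness some point of [K] lies in
    every one. *)
Lemma compact_sublevel_min (R : realType) (X : topologicalType) (K : set X)
    (h : X -> R) :
  compact K -> K !=set0 ->
  (forall r, closed (K `&` [set x | h x <= r])) ->
  exists2 x, K x & forall z, K z -> h x <= h z.
Proof.
move=> cK [z0 Kz0] clh.
have [|s sK|x Kx hx] := @compact_finite_intersection X R K (h @` K)
    (fun r => K `&` [set x | h x <= r]) cK.
- by move=> r _; exact: clh.
- suff [x Kx hx] : exists2 x, K x & forall r, r \in s -> h x <= r.
    by exists x => // r /hx.
  elim: s sK => [_|r s IH sK]; first by exists z0.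
  have [i si|x Kx hx] := IH; first by apply: sK; rewrite inE si orbT.
  have [|z Kz hz] := sK r; first by rewrite inE eqxx.
  have [hxz|hzx] := leP (h x) (h z).
    by exists x => // i; rewrite inE => /orP[/eqP->|/hx//]; rewrite -hz.
  exists z => // i; rewrite inE => /orP[/eqP->|/hx]; first by rewrite hz.
  exact/le_trans/ltW.
- exists x => // z Kz; have [|_] := hx (h z); last exact.
  by exists z.
Qed.

(** * Compact convex hulls of finite sets *)

Lemma convex_setP (R : realType) (Y : lmodType R) (C : set Y) :
  convex_set C <-> forall (x y : Y) (t : R), 0 <= t -> t <= 1 ->
    C x -> C y -> C (t *: x + (1 - t) *: y).
Proof.
split=> [cC x y t t0 t1 Cx Cy|cC x y l].
  have := cC x y (Itv01 t0 t1).
  by rewrite !inE; exact.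
rewrite !inE => Cx Cy; exact: cC.
Qed.

(** Compactness holds because [J] is a continuous image of [[0, 1] x K]. For convexity, the terms in
    [y] are collected and the weights [c], [d] left on [K] are renormalized by [c + d]. *)
Lemma compact_convex_join (R : realType) (Y : normedModType R) (y : Y)
    (K : set Y) :
  compact K -> convex_set K ->
  let J := [set p.1 *: y + (1 - p.1) *: p.2 | p in `[0, 1] `*` K] in
  compact J /\ convex_set J.
Proof.
move=> cK /convex_setP vK; split.
  apply: continuous_compact; last exact/compact_setX/cK/segment_compact.
  apply: continuous_subspaceT => -[t z].
  apply: cvgD; first by apply: cvgZ; [exact: cvg_fst|exact: cvg_cst].
  by apply: cvgZ; [apply: cvgB; [exact: cvg_cst|exact: cvg_fst]|exact: cvg_snd].
apply/convex_setP => _ _ s s0 s1 [[t z] [/= t01 Kz] <-] [[u w] [/= u01 Kw] <-].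
move: t01 u01; rewrite /= !in_itv/= => /andP[t0 t1] /andP[u0 u1].
set a := s * t + (1 - s) * u; set c := s * (1 - t); set d := (1 - s) * (1 - u).
have c0 : 0 <= c by rewrite mulr_ge0 // subr_ge0.
have d0 : 0 <= d by rewrite mulr_ge0 // subr_ge0.
have aE : 1 - a = c + d by rewrite /a /c /d; ring.
have a0 : 0 <= a by rewrite addr_ge0 // mulr_ge0 // subr_ge0.
have -> : s *: (t *: y + (1 - t) *: z) + (1 - s) *: (u *: y + (1 - u) *: w) =
    a *: y + (c *: z + d *: w).
  by rewrite !scalerDr !scalerA /a scalerDl addrACA.
have a01 : a \in `[0, 1].
  by rewrite in_itv/= a0 -subr_ge0 aE addr_ge0.
(* If [c + d = 0], the combination is [y] itself and any point of [K] can serve as second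
   component. *)
have [cd0|cd0] := eqVneq (c + d) 0.
  have [c00 d00] : c = 0 /\ d = 0 by split; lra.
  exists (a, z); first by [].
  by rewrite /= aE cd0 c00 d00 !scale0r !addr0.
have cd_gt0 : 0 < c + d by rewrite lt_neqAle eq_sym cd0 addr_ge0.
exists (a, c / (c + d) *: z + (1 - c / (c + d)) *: w) => /=.
  split=> //=; apply: vK => //; first by rewrite divr_ge0 // ltW.
  by rewrite ler_pdivrMr // mul1r lerDl.
rewrite aE scalerDr !scalerA; congr (_ + (_ *: _ + _ *: _)); by field.
Qed.

(** Vertices are joined one at a time, starting from the singleton of [y0], which keeps [K]
    nonempty. *)
Lemma compact_convex_hull_seq (R : realType) (Y : normedModType R) (C : set Y)
    (y0 : Y) (s : seq Y) :
  convex_set C -> (forall y, y \in y0 :: s -> C y) ->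
  exists K : set Y, [/\ compact K, convex_set K, K `<=` C &
    forall y, y \in y0 :: s -> K y].
Proof.
move=> /convex_setP vC; elim: s => [|y s IH] sC.
  exists [set y0]; split; first exact: compact_set1.
  - apply/convex_setP => _ _ t _ _ -> ->.
    by rewrite /= -scalerDl addrC subrK scale1r.
  - by move=> _ ->; apply: sC; rewrite mem_head.
  - by move=> y; rewrite inE => /eqP ->.
have [z zs|K [cK vK KC sK]] := IH.
  by apply: sC; move: zs; rewrite !inE => /orP[->|->]; rewrite ?orbT.
have Cy : C y by apply: sC; rewrite !inE eqxx orbT.
have /= [cJ vJ] := compact_convex_join y cK vK.
exists [set p.1 *: y + (1 - p.1) *: p.2 | p in `[0, 1] `*` K]; split=> //.
- move=> _ [[t z] [/= t01 Kz] <-] /=.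
  move: t01; rewrite /= in_itv/= => /andP[t0 t1].
  by apply: vC => //; exact: KC.
- have K0 : K y0 by apply: sK; rewrite mem_head.
  have inK z : K z -> [set p.1 *: y + (1 - p.1) *: p.2 | p in `[0, 1] `*` K] z.
    move=> Kz; exists (0, z); first by split=> //=; rewrite in_itv/= lexx ler01.
    by rewrite /= scale0r add0r subr0 scale1r.
  move=> z; rewrite !inE => /or3P[/eqP->|/eqP->|zs].
  - exact: inK.
  - exists (1, y0); first by split=> //=; rewrite in_itv/= lexx ler01.
    by rewrite /= scale1r subrr scale0r addr0.
  - by apply: inK; apply: sK; rewrite inE zs orbT.
Qed.

(** * Minimax under uniqueness of minimizers *)

(* With [x_t] the minimizer at [y_t := t y1 + (1 - t) ym], maximality of [ym]
   gives [f x_t y1 <= v] and [f x_t ym <= v + O(t)] for [v := f xm ym]. Hence the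
   minimum of [f^~ ym] over the compact set [K := {f^~ y1 <= v}] is [v], so [K]
   contains [xm], the only minimizer. *)
Lemma unique_min_at_max (R : realType) (X : topologicalType) (Y : lmodType R)
    (f : X -> Y -> R) (ym y1 : Y) (xm x1 : X) :
  (forall x t y z, f x (t *: y + (1 - t) *: z) = t * f x y + (1 - t) * f x z) ->
  inf_compact (f^~ y1) ->
  (forall r, closed [set x | f x ym <= r]) ->
  (forall r, closed [set x | f x y1 <= r]) ->
  global_min (f^~ ym) xm -> (forall x, global_min (f^~ ym) x -> x = xm) ->
  global_min (f^~ y1) x1 ->
  (forall t, 0 < t < 1 -> exists2 x,
     global_min (f^~ (t *: y1 + (1 - t) *: ym)) x &
     f x (t *: y1 + (1 - t) *: ym) <= f xm ym) ->
  f xm y1 <= f xm ym.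
Proof.
move=> aff icf clm cl1 xm_min xm_uniq x1_min maxm.
set v := f xm ym; set K := [set x | f x y1 <= v].
have cK : compact K.
  suff -> : K = (f^~ y1) @^-1` `]-oo, v] by exact: icf.
  by apply/seteqP; split=> x /=; rewrite in_itv.
(* Since [f x ym >= v], an average of [f x y1] and [f x ym] that is at most [v] forces
   [f x y1 <= v]. *)
have below t x : 0 < t < 1 ->
    f x (t *: y1 + (1 - t) *: ym) <= v -> K x.
  move=> /andP[t0 t1]; rewrite aff /K /= => h.
  have := xm_min x; rewrite -/v => hx; rewrite -(ler_pM2l t0); nra.
have [||x Kx x_min] := @compact_sublevel_min R X K (f^~ ym) cK.
- have half01 : 0 < (2^-1 : R) < 1 by lra.
  have [z _ hz] := maxm _ half01; exists z; exact: below half01 hz.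
- by move=> r; apply: closedI; [exact: cl1|exact: clm].
suff fxv : f x ym <= v.
  suff <- : x = xm by [].
  by apply: xm_uniq => z; exact: le_trans fxv (xm_min z).
rewrite leNgt; apply/negP => vx.
set a := f x ym - v; set A := f xm y1 - f x1 y1.
have a0 : 0 < a by rewrite subr_gt0.
have A0 : 0 <= A by rewrite subr_ge0; exact: x1_min.
have aA : 0 < 2 * (a + A) by lra.
(* Minimality of [z] at this [t] will give [(1 - t) * a <= t * A], that is
   [a <= t * (a + A) = a / 2], which is absurd. *)
set t := a / (2 * (a + A)).
have tE : t * (2 * (a + A)) = a by rewrite /t divfK // gt_eqF.
have t0 : 0 < t by rewrite divr_gt0.
have t1 : t < 1 by rewrite ltr_pdivrMr //; lra.
have t01 : 0 < t < 1 by rewrite t0.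
have [z z_min zv] := maxm _ t01.
have := z_min xm; rewrite /= !aff -/v => hz.
have hxz := x_min z (below _ _ t01 zv).
have h1 := x1_min z; rewrite /= in h1.
have : (1 - t) * a <= t * A.
  have : (1 - t) * f x ym <= (1 - t) * f z ym.
    by rewrite ler_wpM2l // subr_ge0 ltW.
  have : t * f x1 y1 <= t * f z y1 by rewrite ler_wpM2l // ltW.
  rewrite /a /A; lra.
lra.
Qed.

Lemma inf_compact_min (R : realType) (X : topologicalType) (g : X -> R)
    (x0 : X) :
  inf_compact g -> (forall r, closed [set x | g x <= r]) ->
  exists x, global_min g x.
Proof.
move=> icg clg.
have KE r : g @^-1` `]-oo, r] = [set x | g x <= r].
  by apply/seteqP; split=> x /=; rewrite in_itv.
have [||x gx x_min] := @compact_sublevel_min R X _ g (icg (g x0)).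
- by exists x0; rewrite KE /=.
- by move=> r; rewrite KE; exact: closedI.
exists x => z; have [gz|gz] := leP (g z) (g x0).
  by apply: x_min; rewrite KE.
by move: gx; rewrite KE /= => /le_trans; apply; exact: ltW.
Qed.

(** Compactness of the sublevel set at [y0] reduces the claim to finitely many [y]. For these, the
    minimizer at the point [ym] of their hull where the minimum is largest works, by
    [unique_min_at_max]. *)
Lemma minimax_unique_min (R : realType) (X : topologicalType)
    (Y : normedModType R) (C : set Y) (f : X -> Y -> R) (v : R) :
  convex_set C -> C !=set0 ->
  (forall x, continuous (f x)) ->
  (forall x t y z, f x (t *: y + (1 - t) *: z) = t * f x y + (1 - t) * f x z) ->
  (forall y, C y -> inf_compact (f^~ y)) ->
  (forall y r, C y -> closed [set x | f x y <= r]) ->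
  (forall y x x', C y ->
     global_min (f^~ y) x -> global_min (f^~ y) x' -> x = x') ->
  (forall y, C y -> exists x, f x y <= v) ->
  exists x, forall y, C y -> f x y <= v.
Proof.
move=> vC [y0 Cy0] ctf aff icf clf uniq_min inf_le.
have [x0 _] := inf_le y0 Cy0.
(* Outside [C] the value of [m] is the dummy [x0]. *)
have /choice[m m_min] : forall y, exists x, C y -> global_min (f^~ y) x.
  move=> y; have [Cy|] := pselect (C y); last by exists x0.
  have [x ?] := inf_compact_min x0 (icf y Cy) (fun r => clf y r Cy).
  by exists x.
have mv y : C y -> f (m y) y <= v.
  by move=> Cy; have [x] := inf_le y Cy; apply: le_trans; exact: m_min.
have [|s sC|x _ xv] := @compact_finite_intersection X Y
  ((f^~ y0) @^-1` `]-oo, v]) C (fun y => [set x | f x y <= v]) (icf _ Cy0 v);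
  last by exists x.
  by move=> y; exact: clf.
have sC' y : y \in y0 :: s -> C y by rewrite inE => /orP[/eqP->|/sC].
have [K [cK /convex_setP vK KC sK]] := compact_convex_hull_seq vC sC'.
have [||ym Kym ym_max] :=
    @compact_sublevel_min R Y K (fun y => - f (m y) y) cK.
- by exists y0; apply: sK; rewrite mem_head.
- move=> r.
  (* As [f (m y) y] is a minimum over [X], its superlevel sets in [K] are intersections of closed
     sets, one for each [x]. *)
  suff -> : K `&` [set y | - f (m y) y <= r] =
      K `&` \bigcap_(x in [set: X]) [set y | - r <= f x y].
    apply: closedI; first exact: (compact_closed (@norm_hausdorff _ _)).
    apply: closed_bigI => x _.
    by apply: (preimage_closed _ (@closed_ge _ _)) => y _; exact: ctf.
  apply/seteqP; split=> y [Ky /= h]; split=> //=.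
    by move=> x _ /=; rewrite lerNl (le_trans _ h)// lerN2; exact/m_min/KC.
  by rewrite lerNl; exact: h.
have key y1 : y1 \in y0 :: s -> f (m ym) y1 <= v.
  move=> y1s; apply: le_trans (mv _ (KC _ Kym)).
  apply: (@unique_min_at_max _ _ _ _ _ _ _ (m y1)) => //.
  - exact/icf/sC'.
  - by move=> r; exact/clf/KC.
  - by move=> r; exact/clf/sC'.
  - exact/m_min/KC.
  - by move=> x hx; apply: (uniq_min ym) => //; [exact: KC|exact/m_min/KC].
  - exact/m_min/sC'.
  - move=> t /andP[t0 t1]; set yt := _ + _.
    have Kyt : K yt by apply: vK; [exact: ltW|exact: ltW|exact: sK|].
    exists (m yt); first exact/m_min/KC.
    by rewrite -lerN2; exact: ym_max.
exists (m ym); first by rewrite /= in_itv/=; apply: key; rewrite mem_head.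
by move=> y ys; apply: key; rewrite inE ys orbT.
Qed.

(** * Inner product estimates, convexity and semicontinuity *)

Lemma norm_induced_sqr (R : realType) (Y : normedModType R)
    (dot : {dot Y for (@idfun R)}) (u : Y) :
  norm_induced_by dot -> dot u u = `|u| ^+ 2.
Proof.
move=> ->; rewrite sqr_sqrtr //.
have [->|u0] := eqVneq u 0; first by rewrite linear0r.
exact/ltW/neq0_dnorm_gt0.
Qed.

Lemma dot_sym (R : realType) (Y : lmodType R) (dot : {dot Y for (@idfun R)})
    (u v : Y) : dot u v = dot v u.
Proof. by rewrite hermC expr0 mul1r. Qed.

Lemma norm_induced_sqrB (R : realType) (Y : normedModType R)
    (dot : {dot Y for (@idfun R)}) (u v : Y) (a : R) : norm_induced_by dot ->
  `|u - a *: v| ^+ 2 = `|u| ^+ 2 - 2 * a * dot u v + a ^+ 2 * `|v| ^+ 2.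
Proof.
move=> hdot; rewrite -!(norm_induced_sqr _ hdot) linearBl !linearBr /=.
have dotZ x y : dot x (a *: y) = a * dot x y by rewrite linearZr.
by rewrite !dotZ (dot_sym dot (a *: v) u) (dot_sym dot (a *: v) v) !dotZ; ring.
Qed.

(** Cauchy-Schwarz: the coefficient [|u| / |v|] gives both vectors the same length, and the square
    of their difference is nonnegative. *)
Lemma dot_le_norm (R : realType) (Y : normedModType R)
    (dot : {dot Y for (@idfun R)}) (u v : Y) :
  norm_induced_by dot -> dot u v <= `|u| * `|v|.
Proof.
move=> hdot.
have [->|v0] := eqVneq v 0; first by rewrite linear0r normr0 mulr0.
have [->|u0] := eqVneq u 0; first by rewrite linear0l normr0 mul0r.
have pu : 0 < `|u| by rewrite normr_gt0.
have pv : 0 < `|v| by rewrite normr_gt0.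
have := sqr_ge0 `|u - (`|u| / `|v|) *: v|.
rewrite (norm_induced_sqrB _ _ _ hdot) exprMn exprVn.
rewrite divfK ?sqrf_eq0 ?normr_eq0 //.
set c := `|u| / `|v|; have c0 : 0 < c by rewrite divr_gt0.
have cE : c * `|v| = `|u| by rewrite divfK // gt_eqF.
rewrite -cE => h.
have h' : 0 <= 2 * c * (c * `|v| * `|v| - dot u v) by lra.
by rewrite -subr_ge0 -(pmulr_rge0 _ (_ : 0 < 2 * c)) // mulr_gt0.
Qed.

Lemma dot_continuous (R : realType) (Y : normedModType R)
    (dot : {dot Y for (@idfun R)}) (u : Y) :
  norm_induced_by dot -> continuous (dot u).
Proof.
move=> hdot y; apply/cvgrPdist_lt => e e0.
near=> z; rewrite -linearBr /=.
apply: (@le_lt_trans _ _ (`|u| * `|y - z|)).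
  rewrite ler_norml dot_le_norm // lerNl -linearNr /=.
  by rewrite -(normrN (y - z)) dot_le_norm.
apply: (@le_lt_trans _ _ ((`|u| + 1) * `|y - z|)).
  by rewrite ler_wpM2r // lerDl.
rewrite mulrC -ltr_pdivlMr ?ltr_wpDl //.
by near: z; apply: cvgr_dist_lt; [exact: cvg_id|rewrite divr_gt0 // ltr_wpDl].
Unshelve. all: by end_near. Qed.

Lemma dense_ball_dot (R : realType) (Y : normedModType R)
    (dot : {dot Y for (@idfun R)}) (S : set Y) (w : Y) (rho e : R) :
  norm_induced_by dot -> dense S -> w != 0 -> 0 < rho -> 0 < e ->
  exists y, [/\ S y, `|y| < rho & rho * `|w| - e < dot w y].
Proof.
move=> hdot denS w0 rho0 e0.
have pw : 0 < `|w| by rewrite normr_gt0.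
(* The value at [y] falls short of [rho * |w|] by less than [2 * d * |w|]: once because [a] has norm
   [rho - d], once because [y] is only [d]-close to [a]. *)
set d := Num.min rho (e / (2 * `|w|)).
have d0 : 0 < d by rewrite lt_min rho0 divr_gt0 // mulr_gt0.
have drho : d <= rho by rewrite ge_min lexx.
have dw : 2 * d * `|w| <= e.
  have : d <= e / (2 * `|w|) by rewrite ge_min lexx orbT.
  by rewrite ler_pdivlMr ?mulr_gt0 //; lra.
set a := ((rho - d) / `|w|) *: w.
have na : `|a| = rho - d.
  rewrite normrZ normrM normfV normr_id divfK ?gt_eqF //.
  by rewrite ger0_norm // subr_ge0.
have [|y [ay Sy]] := denS _ _ (ball_open a d).
  by by exists a; exact: ballxx.
move: ay; rewrite -ball_normE /= => ay.
exists y; split=> //.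
  have -> : y = a - (a - y) by rewrite subKr.
  by apply: le_lt_trans (ler_normB _ _) _; rewrite na; lra.
have aw : dot w a = (rho - d) * `|w|.
  rewrite linearZr /= (norm_induced_sqr _ hdot) expr2 mulrA divfK //.
  by rewrite gt_eqF.
have : dot w (a - y) < `|w| * d.
  by apply: le_lt_trans (dot_le_norm _ _ hdot) _; rewrite ltr_pM2l.
rewrite linearBr /= aw; lra.
Qed.

Lemma convex_ball0 (R : realType) (Y : normedModType R) (S : set Y) (rho : R) :
  convex_set S -> convex_set (S `&` [set y : Y | `|y| < rho]).
Proof.
move=> /convex_setP vS; apply/convex_setP => y z t t0 t1 [Sy /= yr] [Sz /= zr].
split; first exact: vS.
have t1' : 0 <= 1 - t by rewrite subr_ge0.
have m_rho : Num.max `|y| `|z| < rho by rewrite gt_max yr zr.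
apply: le_lt_trans m_rho; apply: le_trans (ler_normD _ _) _.
rewrite !normrZ !ger0_norm //; set m := Num.max _ _.
have -> : m = t * m + (1 - t) * m by ring.
by rewrite lerD // ler_wpM2l // le_max lexx ?orbT.
Qed.

Lemma lower_semicontinuous_closed (R : realType) (X : topologicalType)
    (g : X -> R) (r : R) :
  lower_semicontinuous (fun x => (g x)%:E) -> closed [set x | g x <= r].
Proof.
move=> /lower_semicontinuousP /(_ r) /open_closedC.
congr closed; apply/seteqP; split=> x /=; rewrite lte_fin leNgt.
  by move/negP.
by move=> /negP.
Qed.

(** * Strict gap and conclusion *)

(* The radius is chosen so that [x1] beats [M := I x0 + rho |phi x0|] by [1] at
   the only point of the closed ball where [x0] reaches [M]. *)
Lemma strict_gap (R : realType) (X : Type) (Y : normedModType R)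
    (dot : {dot Y for (@idfun R)}) (I : X -> R) (phi : X -> Y) (x0 x1 : X) :
  norm_induced_by dot -> I x0 <= I x1 ->
  dot (phi x1) (phi x0) < `|phi x0| ^+ 2 ->
  exists rho d : R, [/\ 0 < rho, 0 < d & forall y, `|y| < rho ->
    exists x, I x + dot (phi x) y <= I x0 + rho * `|phi x0| - d].
Proof.
move=> hdot I01 lt1.
set n0 := `|phi x0|; set q := n0 ^+ 2 - dot (phi x1) (phi x0).
have q0 : 0 < q by rewrite subr_gt0.
have n0_gt0 : 0 < n0.
  rewrite normr_gt0; apply/eqP => phi0; move: lt1.
  by rewrite phi0 linear0r normr0 expr0n ltxx.
(* The critical point is [s *: phi x0], of norm [rho = s * n0]; there the value of [x1] is exactly
   [M - 1]. *)
set s := (I x1 - I x0 + 1) / q.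
have s0 : 0 < s by rewrite divr_gt0 // ltr_wpDl // subr_ge0.
have sq : s * q = I x1 - I x0 + 1 by rewrite divfK // gt_eqF.
(* Within [eta] of the critical point the value of [x1] grows by at most [1 / 2]. *)
set eta := (2 * (`|phi x1| + 1))^-1.
have p1 : 0 < `|phi x1| + 1 by rewrite ltr_wpDl.
have eta0 : 0 < eta by rewrite invr_gt0 mulr_gt0.
have etaE : eta * (2 * (`|phi x1| + 1)) = 1.
  by rewrite mulVf // gt_eqF // mulr_gt0.
(* The second term serves far from the critical point: expanding [|y - s *: phi x0| ^+ 2 > eta ^+ 2]
   with [|y| < s * n0] puts [x0] below [M] by [eta ^+ 2 / (2 * s)]. *)
set d := Num.min 2^-1 (eta ^+ 2 / (2 * s)).
exists (s * n0), d; split; first exact: mulr_gt0.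
  by rewrite lt_min invr_gt0 ltr0n /= divr_gt0 // ?exprn_gt0 // mulr_gt0.
move=> y yr; have [near_y|far_y] := leP `|y - s *: phi x0| eta.
  exists x1.
  have d2 : d <= 2^-1 by rewrite ge_min lexx.
  have : dot (phi x1) (y - s *: phi x0) <= `|phi x1| * eta.
    by apply: le_trans (dot_le_norm _ _ hdot) _; rewrite ler_wpM2l.
  rewrite linearBr linearZr /=; rewrite /q in sq; nra.
exists x0.
have dE : d * (2 * s) <= eta ^+ 2.
  have : d <= eta ^+ 2 / (2 * s) by rewrite ge_min lexx orbT.
  by rewrite ler_pdivlMr // mulr_gt0.
have : eta ^+ 2 < `|y - s *: phi x0| ^+ 2 by rewrite ltr_pXn2r ?nnegrE // ltW.
rewrite (norm_induced_sqrB _ _ _ hdot) (dot_sym dot y) -/n0 => far2.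
have y2 : `|y| ^+ 2 < (s * n0) ^+ 2.
  by rewrite ltr_pXn2r ?nnegrE // mulr_ge0 // ltW.
have : 2 * s * dot (phi x0) y <= 2 * s * (s * n0 * n0 - d) by nra.
by rewrite (ler_pM2l (mulr_gt0 (ltr0Sn _ 1) s0)); lra.
Qed.

Theorem theorem2p1 (R : realType) (X : topologicalType)
    (Y : completeNormedModType R) (dot : {dot Y for (@idfun R)})
    (hdot : norm_induced_by dot)
    (T : set Y) (convexT : convex_set T) (denseT : dense T)
    (I : X -> R) (phi : X -> Y)
    (hI : forall y : Y, T y ->
       lower_semicontinuous (fun x => (I x + dot (phi x) y)%:E) /\
       inf_compact (fun x => I x + dot (phi x) y))
    (hx0 : exists x0 : X,
       [/\ phi x0 != 0,
           global_min I x0,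
           global_min (fun x => `|phi x|) x0 &
           (ereal_inf (range (fun x => (dot (phi x) (phi x0))%:E)) <
              (`|phi x0| ^+ 2)%:E)%E]) :
  forall S : set Y, S `<=` T -> convex_set S -> dense S ->
    exists2 ystar : Y, S ystar &
      exists x1 x2 : X,
        [/\ x1 <> x2,
            global_min (fun x => I x + dot (phi x) ystar) x1 &
            global_min (fun x => I x + dot (phi x) ystar) x2].
Proof.
move=> S ST vS denS; apply: contrapT => no_two.
have [x0 [phi0 I_min norm_min /ereal_inf_lt[_ [x1 _ <-]]]] := hx0.
rewrite lte_fin => lt1.
have [rho [d [rho0 d0 gap]]] := strict_gap hdot (I_min x1) lt1.
(* The open ball matches the range of [y] covered by [gap]. *)
set C := S `&` [set y : Y | `|y| < rho].
have [||||y r [/ST/hI[lscy _] _]|y x x' [Sy _] xm x'm|y [_]|x xle] :=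
    @minimax_unique_min R X Y C (fun x y => I x + dot (phi x) y)
      (I x0 + rho * `|phi x0| - d) (convex_ball0 vS).
- have [y [Sy yr _]] := dense_ball_dot hdot denS phi0 rho0 ltr01.
  by exists y.
- by move=> x y; apply: cvgD; [exact: cvg_cst|exact: dot_continuous].
- by move=> x t y z; rewrite linearDr !linearZr /=; ring.
- by move=> y [/ST/hI[]].
- exact: (lower_semicontinuous_closed lscy).
- apply: contrapT => xx'; apply: no_two; exists y => //.
  by exists x, x'.
- exact: gap.
have phix : phi x != 0.
  by rewrite -normr_gt0 (lt_le_trans _ (norm_min x)) // normr_gt0.
(* This [y] in [C] makes the value at [x] exceed [I x + rho * |phi x| - d], hence
   [I x0 + rho * |phi x0| - d], against [xle]. *)
have [y [Sy yr wy]] := dense_ball_dot hdot denS phix rho0 d0.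
have := xle y (conj Sy yr); have := I_min x.
have : rho * `|phi x0| <= rho * `|phi x| by rewrite ler_pM2l.
lra.
Qed.
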